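(* Let $\mathbb K$ be a field, $R:=\mathbb K[x_0,\ldots,x_n]$, and $M:=\langle x_0,\ldots,x_n\rangle$. Let $s\geq n+1$ and let $\mathcal A=\{H_1,\ldots,H_s\}$ be a generic collection of hyperplanes in $\mathbb P^n$, with $H_i=V(\ell_i)$ for linear forms $\ell_1,\ldots,\ell_s\in R$. Let $1\leq c\leq n$. Then for any $m\geq 1$ one has $$I(V_c(\mathcal A))^m=I(V_c(\mathcal A))^{(m)}\cap I(V_{c+1}(\mathcal A))^{(2m)}\cap\cdots\cap I(V_n(\mathcal A))^{((n-c+1)m)}\cap M^{(s-c+1)m}.$$
   Context: The collection $\mathcal A$ is generic if any $n+1$ of the linear forms $\ell_1,\ldots,\ell_s$ are linearly independent. For $1\le c\le n$, the star configuration of codimension $c$ with support $\mathcal A$ in $\mathbb P^n$ is $$V_c(\mathcal A):=\bigcup_{1\leq j_1<\cdots<j_c\leq s}H_{j_1}\cap\cdots\cap H_{j_c}.$$ Its defining ideal is $$I(V_c(\mathcal A))=\bigcap_{1\leq j_1<\cdots<j_c\leq s}\langle \ell_{j_1},\ldots,\ell_{j_c}\rangle,$$ and for $k\geq 1$ the $k$-th symbolic power of this ideal is $$I(V_c(\mathcal A))^{(k)}=\bigcap_{1\leq j_1<\cdots<j_c\leq s}\langle \ell_{j_1},\ldots,\ell_{j_c}\rangle^k.$$ Powers without parentheses in the exponent are ordinary powers of ideals. *)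

(* Defs.v *)
From HB Require Import structures.
From mathcomp Require Import all_boot all_order all_algebra.
From mathcomp Require Import classical_sets.
From mathcomp Require Export mpoly.

Set Implicit Arguments.
Unset Strict Implicit.
Unset Printing Implicit Defensive.

Import GRing.Theory.

Local Open Scope ring_scope.
Local Open Scope classical_set_scope.

(* Ideals are represented by their underlying sets of ring elements. *)
Section Ideals.
Variable R : comNzRingType.
Implicit Types (S I J : set R).

Definition ideal_gen S : set R :=
  [set f | exists (r : nat) (a g : 'I_r -> R),
     (forall i, S (g i)) /\ f = \sum_(i < r) a i * g i].

Definition ideal_mul I J : set R :=
  ideal_gen [set f | exists g h, [/\ I g, J h & f = g * h]].

Definition ideal_exp I (k : nat) : set R := iter k (ideal_mul I) setT.

End Ideals.

(* <x_0, ..., x_n> *)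
Definition irrelevant_ideal (K : fieldType) (n : nat) : set {mpoly K[n.+1]} :=
  ideal_gen (range (fun i : 'I_n.+1 => 'X_i : {mpoly K[n.+1]})).
Arguments irrelevant_ideal : clear implicits.

Section StarConfigurations.
Variables (K : fieldType) (n s : nat) (ell : 'I_s -> dhomog n.+1 K 1).

(* Indexed by positions, so a form repeated among the n+1 counts as dependent. *)
Definition generic : Prop :=
  forall J : {set 'I_s}, #|J| = n.+1 -> free [seq ell j | j <- enum J].

(* The ideal of the linear subspace cut out by the H_j, j in J. *)
Definition flat_ideal (J : {set 'I_s}) : set {mpoly K[n.+1]} :=
  ideal_gen [set mpoly_of_dhomog (ell j) | j in [set` J]].

(* The sets J with c elements stand for the tuples j_1 < ... < j_c. *)
Definition star_ideal (c : nat) : set {mpoly K[n.+1]} :=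
  \bigcap_(J in [set J : {set 'I_s} | #|J| = c]) flat_ideal J.

Definition star_symbolic_power (c k : nat) : set {mpoly K[n.+1]} :=
  \bigcap_(J in [set J : {set 'I_s} | #|J| = c]) ideal_exp (flat_ideal J) k.

End StarConfigurations.

(* Main.v *)
Require Import Defs.
From mathcomp Require Import all_boot all_order all_algebra.
From mathcomp Require Import classical_sets.
From mathcomp Require Import zify.

Local Open Scope classical_set_scope.

(** The idea is to prove a more general statement by induction.  Give each form
    [l_i] a cap [b_i], and let [J(b, D)] be the ideal generated by the products
    [\prod l_i ^ a_i] of degree [D] with [a_i <= b_i].  A product of this kind has
    at least [D - \sum_(i notin F) b_i] factors among the [l_i] with [i \in F], so it
    lies in that power of the ideal [<l_F>] of the flat [F], and also in [M^D].  For
    generic forms these conditions, imposed for all [F] with at most [n] elements,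
    characterize [J(b, D)] ([capped_ideal_of_local_conditions]).

    For the converse, choose [j] with [b_j > 0] and reduce modulo [l_j].  The
    conditions attached to the flats through [j] become the conditions for the
    remaining forms, [b_j] being replaced by 0, on a projective space of dimension
    one less.  By induction [f = p + l_j * h] with [p] in [J(b, D)].  As [l_j] can
    be cancelled from the local conditions ([cancel_form]), [h] satisfies those for
    [D - 1] and for the caps with [b_j] lowered by one, and the induction applies to
    [h] as well.  Instead of changing rings, everything is stated modulo an ideal
    [<l_G>], where [G] collects the forms already set to zero.  At most [n + 1]
    forms occur in a cancellation; by genericity they may be taken for variables,
    and the ideals concerned become monomial ([monomial_criterion]).

    With all caps equal to [m] and [D = (s - c + 1) m], the local conditions are
    exactly those on the right-hand side of the theorem.  It remains to see that
    [J(b, D)] is the [m]-th power of the ideal of the star configuration.  The latter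
    ideal is [J(1, s - c + 1)]: the same reduction modulo a form gives one inclusion
    ([star_capped], [star_subset_capped]), and the other holds since a set of
    [s - c + 1] indices meets every set of [c] indices.  Finally a vector with entries
    at most [m] and sum [d m] is a sum of [m] vectors with entries 0 and 1 and sum
    [d] ([capped_ideal_subset_exp]). *)

Section StarConfigurationPowers.
Import GRing.Theory.
Local Open Scope ring_scope.
Set Implicit Arguments.
Unset Strict Implicit.

(** * Ideals as sets *)
Section IdealCalculus.
Variable R : comNzRingType.
Implicit Types (S I J : set R) (f g : R).

Definition is_ideal I :=
  [/\ I 0, forall f g, I f -> I g -> I (f + g) & forall a f, I f -> I (a * f)].

Lemma ideal_gen_ideal S : is_ideal (ideal_gen S).
Proof.
split=> [|f g [r [a [u [Su ->]]]] [t [b [v [Sv ->]]]]|a f [r [b [u [Su ->]]]]].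
- by exists 0%N, (fun=> 0), (fun=> 0); split=> [[]//|]; rewrite big_ord0.
- exists (r + t)%N, (fun i => match split i with inl j => a j | inr j => b j end).
  exists (fun i => match split i with inl j => u j | inr j => v j end); split.
    by move=> i; case: (split i).
  rewrite big_split_ord /=; congr (_ + _); apply: eq_bigr => i _.
    by rewrite -[lshift _ _]/(unsplit (inl i)) unsplitK.
  by rewrite -[rshift _ _]/(unsplit (inr i)) unsplitK.
- exists r, (fun i => a * b i), u; split=> //.
  by rewrite big_distrr /=; apply: eq_bigr => i _; rewrite mulrA.
Qed.

Lemma sub_ideal_gen S : S `<=` ideal_gen S.
Proof.
move=> f Sf; exists 1%N, (fun=> 1), (fun=> f); split=> //.
by rewrite big_ord1 mul1r.
Qed.

Lemma ideal_sum I (T : Type) (r : seq T) (P : pred T) (F : T -> R) :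
  is_ideal I -> (forall i, P i -> I (F i)) -> I (\sum_(i <- r | P i) F i).
Proof. by case=> I0 ID _ IF; apply: big_ind. Qed.

Lemma ideal_gen_min S I : is_ideal I -> S `<=` I -> ideal_gen S `<=` I.
Proof.
move=> idI SI f [r [a [u [Su ->]]]]; apply: ideal_sum => // i _.
by case: idI => _ _; apply; apply: SI.
Qed.

Lemma ideal_gen_subset S S' : S `<=` S' -> ideal_gen S `<=` ideal_gen S'.
Proof.
move=> SS'; apply: ideal_gen_min; first exact: ideal_gen_ideal.
by move=> f /SS' /sub_ideal_gen.
Qed.

Lemma idealB I f g : is_ideal I -> I f -> I g -> I (f - g).
Proof. by case=> _ ID IM If Ig; apply: ID => //; rewrite -mulN1r; apply: IM. Qed.

Lemma ideal_exp_ideal I k : is_ideal (ideal_exp I k).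
Proof. by case: k => [|k]; [split | apply: ideal_gen_ideal]. Qed.

Lemma ideal_exp1 I : is_ideal I -> ideal_exp I 1 = I.
Proof.
move=> idI; apply/seteqP; split; last first.
  by move=> f If; apply: sub_ideal_gen; exists f, 1; rewrite mulr1.
apply: ideal_gen_min => // _ [g [h [Ig _ ->]]].
by rewrite mulrC; case: idI => _ _; apply.
Qed.

Lemma ideal_expM I a b f g :
  ideal_exp I a f -> ideal_exp I b g -> ideal_exp I (a + b) (f * g).
Proof.
move=> + Ig; elim: a f => [|a IHa] f.
  by move=> _; case: (ideal_exp_ideal I b) => _ _; apply.
have [I0 ID IM] := ideal_exp_ideal I (a.+1 + b).
pose C := [set h | ideal_exp I (a.+1 + b) (h * g)].
have idC : is_ideal C.
  split=> [|u v Cu Cv|u v Cv]; rewrite /C /= ?mul0r //.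
    by rewrite mulrDl; apply: ID.
  by rewrite -mulrA; apply: IM.
apply: (ideal_gen_min idC) => _ [u [v [Iu Iv ->]]].
apply: sub_ideal_gen; rewrite -mulrA.
by exists u, (v * g); split=> //; apply: IHa.
Qed.

Lemma ideal_exp_subset I J k : I `<=` J -> ideal_exp I k `<=` ideal_exp J k.
Proof.
move=> IJ; elim: k => [//|k IHk]; apply: ideal_gen_subset => _ [g [h [Ig Ih ->]]].
by exists g, h; split=> //; [apply: IJ | apply: IHk].
Qed.

Lemma ideal_exp_le I a b : (a <= b)%N -> ideal_exp I b `<=` ideal_exp I a.
Proof.
move=> /subnK <-; elim: (b - a)%N => [//|k IHk] f If; apply: IHk.
move: f If; apply: ideal_gen_min; first exact: ideal_exp_ideal.
move=> _ [g [h [_ Ih ->]]].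
by case: (ideal_exp_ideal I (k + a)) => _ _; apply.
Qed.

(** Counts the factors of a monomial that lie in [I]; the other factors only
    multiply an element of a power of [I]. *)
Lemma ideal_exp_prod (T : finType) (X : pred T) (g : T -> R) (a : T -> nat) I :
  (forall i, X i -> I (g i)) ->
  ideal_exp I (\sum_(i | X i) a i)%N (\prod_i g i ^+ a i).
Proof.
move=> Ig; rewrite [p in ideal_exp _ _ p](bigID X) /= mulrC.
case: (ideal_exp_ideal I (\sum_(i | X i) a i)%N) => _ _; apply.
apply: (big_ind2 (fun k h => ideal_exp I k h)) => // [k h k' h'|i Xi].
  exact: ideal_expM.
elim: (a i) => [//|k IHk]; rewrite exprS; apply: sub_ideal_gen.
by exists (g i), (g i ^+ k); split=> //; apply: Ig.
Qed.

Definition ideal_add I J : set R :=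
  [set f | exists g h, [/\ I g, J h & f = g + h]].

Lemma ideal_add_ideal I J : is_ideal I -> is_ideal J -> is_ideal (ideal_add I J).
Proof.
move=> [I0 ID IM] [J0 JD JM].
split=> [|_ _ [g [h [Ig Jh ->]]] [g' [h' [Ig' Jh' ->]]]|a _ [g [h [Ig Jh ->]]]].
- by exists 0, 0; rewrite addr0.
- by exists (g + g'), (h + h'); rewrite addrACA; split; [apply: ID|apply: JD|].
- by exists (a * g), (a * h); rewrite mulrDr; split; [apply: IM|apply: JM|].
Qed.

Lemma ideal_add_subset I J I' J' :
  I `<=` I' -> J `<=` J' -> ideal_add I J `<=` ideal_add I' J'.
Proof.
move=> II' JJ' _ [g [h [Ig Jh ->]]].
by exists g, h; split=> //; [apply: II'|apply: JJ'].
Qed.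

Lemma ideal_add_min I J H :
  is_ideal H -> I `<=` H -> J `<=` H -> ideal_add I J `<=` H.
Proof.
by move=> [_ HD _] IH JH _ [g [h [Ig Jh ->]]]; apply: HD; [apply: IH|apply: JH].
Qed.

Lemma ideal_addl I J : is_ideal J -> I `<=` ideal_add I J.
Proof. by case=> J0 _ _ f If; exists f, 0; rewrite addr0. Qed.

Lemma ideal_addr I J : is_ideal I -> J `<=` ideal_add I J.
Proof. by case=> I0 _ _ f Jf; exists 0, f; rewrite add0r. Qed.

Lemma ideal_exp_add I J k :
  is_ideal I -> is_ideal J ->
  ideal_exp (ideal_add I J) k `<=` ideal_add (ideal_exp I k) J.
Proof.
move=> idI idJ; elim: k => [|k IHk]; first exact: ideal_addl.
have idE := ideal_exp_ideal I k.+1.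
apply: ideal_gen_min; first exact: ideal_add_ideal.
move=> _ [_ [_ [[u [v [Iu Jv ->]]] /IHk[u' [v' [Iu' Jv' ->]]] ->]]].
case: idJ => _ JD JM; exists (u * u'), (u * v' + (u' + v') * v).
split=> //; last by rewrite mulrDl [u * _]mulrDr -addrA [v * _]mulrC.
  by apply: sub_ideal_gen; exists u, u'.
by apply: JD; apply: (JM).
Qed.

End IdealCalculus.

Lemma ideal_preimage (R R' : comNzRingType) (phi : {rmorphism R' -> R}) (I : set R) :
  is_ideal I -> is_ideal (phi @^-1` I).
Proof.
move=> [I0 ID IM]; split=> [|f g|a f]; rewrite /= ?rmorph0 //.
  by move=> If Ig; rewrite rmorphD; apply: ID.
by move=> If; rewrite rmorphM; apply: IM.
Qed.

(** * Sets of prescribed size *)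
Lemma exists_intermediate_set (T : finType) (A B : {set T}) (k : nat) :
  A \subset B -> (#|A| <= k <= #|B|)%N ->
  exists C : {set T}, [/\ A \subset C, C \subset B & #|C| = k].
Proof.
move=> sAB /andP[]; elim: k => [|k IHk].
  rewrite leqn0 => /eqP A0 _; exists A; split=> //.
rewrite leq_eqVlt => /predU1P[Ak _|lAk lkB]; first by exists A.
have [C [sAC sCB cC]] := IHk lAk (ltnW lkB).
have /subsetPn[x Bx Cx] : ~~ (B \subset C).
  by apply/negP => /subset_leq_card; rewrite cC leqNgt lkB.
exists (x |: C); rewrite cardsU1 Cx cC; split=> //.
  exact: fintype.subset_trans sAC (finset.subsetUr _ _).
by rewrite finset.subUset finset.sub1set Bx.
Qed.

(** * Ideals defined by conditions on monomials *)
Section Monomials.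
Variables (K : fieldType) (n : nat).
Implicit Types (X : pred 'I_n) (m : 'X_{1..n}).

Definition degree_in X m := (\sum_(i | X i) m i)%N.

Definition supported_in (Q : pred 'X_{1..n}) : set {mpoly K[n]} :=
  [set p | forall m, m \in msupp p -> Q m].

Lemma degree_inD X m m' :
  degree_in X (m + m')%MM = (degree_in X m + degree_in X m')%N.
Proof. by rewrite -big_split; apply: eq_bigr => i _; rewrite mnmDE. Qed.

Lemma degree_in1 X i : degree_in X U_(i)%MM = X i.
Proof.
rewrite /degree_in big_mkcond (bigD1 i) //= big1 => [|j ji].
  by rewrite mnm1E eqxx addn0; case: (X i).
by rewrite mnm1E eq_sym (negPf ji) if_same.
Qed.

Lemma supported_in_ideal (Q : pred 'X_{1..n}) :
  (forall m m', Q m -> Q (m' + m)%MM) -> is_ideal (supported_in Q).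
Proof.
move=> QD; split=> [m|p q Qp Qq m|a p Qp m].
- by rewrite msupp0.
- by move/msuppD_le; rewrite mem_cat => /orP[/Qp|/Qq].
- by move/msuppM_le => /allpairsP[[m1 m2] /= [_ /Qp Qm ->]]; apply: QD.
Qed.

Lemma supported_in_exp X (phi : {rmorphism {mpoly K[n]} -> {mpoly K[n]}}) I e :
  I `<=` phi @^-1` supported_in (fun m => 0 < degree_in X m)%N ->
  ideal_exp I e `<=` phi @^-1` supported_in (fun m => e <= degree_in X m)%N.
Proof.
have idX k : is_ideal (supported_in (fun m => k <= degree_in X m)%N).
  apply: supported_in_ideal => m m' km; rewrite degree_inD.
  exact: leq_trans km (leq_addl _ _).
move=> IX; elim: e => [//|e IHe].
apply: ideal_gen_min; first exact: ideal_preimage.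
move=> _ [g [h [/IX Xg /IHe Xh ->]]] m; rewrite /= rmorphM.
move/msuppM_le => /allpairsP[[m1 m2] /= [/Xg m1X /Xh m2X ->]].
by rewrite degree_inD -addn1 addnC leq_add.
Qed.

End Monomials.

(** * Coordinates adapted to generic forms *)
Lemma linear_formE (K : fieldType) (n : nat) (l : dhomog n.+1 K 1) :
  (l : {mpoly K[n.+1]}) = \sum_i (mpoly_of_dhomog l)@_U_(i) *: 'X_i.
Proof.
apply/mpolyP => m; rewrite raddf_sum /=.
under eq_bigr do rewrite mcoeffZ mcoeffX.
have [/eqP/mdeg1P[i /eqP ->]|m1] := eqVneq (mdeg m) 1%N.
  rewrite (bigD1 i) //= eqxx mulr1 big1 ?addr0 // => j ji.
  by rewrite eq_mnm1 (negPf ji) mulr0.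
rewrite (dhomog_nemf_coeff (dhomog_is_dhomog l) m1) big1 // => i _.
by case: eqP => [Em|]; rewrite ?mulr0 //; rewrite -Em mdeg1 eqxx in m1.
Qed.

Section Forms.
Variables (K : fieldType) (n s : nat) (ell : 'I_s -> dhomog n.+1 K 1).
Hypothesis hgen : generic ell.
Local Notation P := {mpoly K[n.+1]}.
Local Notation L j := (mpoly_of_dhomog (ell j)).
Local Notation flat := (flat_ideal ell).
Local Notation M := (irrelevant_ideal K n).
Implicit Types (F G T J : {set 'I_s}) (f g h : P).

Lemma flat_is_ideal J : is_ideal (flat J).
Proof. exact: ideal_gen_ideal. Qed.

Lemma flat_form J j : j \in J -> flat J (L j).
Proof. by move=> jJ; apply: sub_ideal_gen; exists j. Qed.

Lemma flat_subset J J' : J \subset J' -> flat J `<=` flat J'.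
Proof.
move/fintype.subsetP => JJ'; apply: ideal_gen_subset => _ [j /= jJ <-].
by exists j => //=; apply: JJ'.
Qed.

Lemma irrelevant_is_ideal : is_ideal M.
Proof. exact: ideal_gen_ideal. Qed.

Lemma flat_subset_irrelevant J : flat J `<=` M.
Proof.
apply: ideal_gen_min; first exact: irrelevant_is_ideal.
move=> _ [j _ <-]; rewrite linear_formE; apply: ideal_sum => [|i _].
  exact: irrelevant_is_ideal.
rewrite -mul_mpolyC; case: irrelevant_is_ideal => _ _; apply.
by apply: sub_ideal_gen; exists i.
Qed.

(** Any [n + 1] of the forms are a basis of the linear forms, so the polynomial
    ring has an automorphism that turns them into the variables.  The automorphism
    [phi] is substitution by the inverse of the coefficient matrix of the forms. *)
Lemma linear_coordinates T : #|T| = n.+1 ->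
  exists (phi psi : {rmorphism P -> P}) (e : 'I_n.+1 -> 'I_s),
  [/\ forall j, j \in T <-> exists i, e i = j,
      forall i, phi (L (e i)) = 'X_i, forall i, psi 'X_i = L (e i) &
      cancel phi psi /\ M `<=` flat T].
Proof.
move=> cT; pose e i := enum_val (cast_ord (esym cT) i).
have eT j : reflect (exists i, e i = j) (j \in T).
  apply: (iffP idP) => [jT|[i <-]]; last exact: enum_valP.
  exists (cast_ord cT (enum_rank_in jT j)).
  by rewrite /e cast_ordK enum_rankK_in.
have fr : free [tuple ell (e i) | i < n.+1].
  suff -> : [tuple ell (e i) | i < n.+1] = [seq ell j | j <- enum T] :> seq _.
    exact: hgen.
  rewrite /= (map_comp ell e); congr map.
  have sz : size (map e (enum 'I_n.+1)) = size (enum T).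
    by rewrite size_map -!cardE card_ord cT.
  apply: (eq_from_nth (x0 := e ord0) sz) => i; rewrite size_map => lti.
  rewrite (nth_map ord0) // /e (enum_val_nth (e ord0)) /=.
  by rewrite nth_enum_ord // -[n.+1]size_enum_ord.
pose A : 'M[K]_n.+1 := \matrix_(k, i) (L (e k))@_U_(i).
have LA k : L (e k) = \sum_i A k i *: 'X_i.
  by rewrite linear_formE; apply: eq_bigr => i _; rewrite mxE.
have uA : A \in unitmx.
  rewrite -row_free_unit; apply: inj_row_free => v vA0.
  have v0 : \sum_(k < n.+1) v 0 k *: [tuple ell (e i) | i < n.+1]`_k = 0.
    have vZ c (l : dhomog n.+1 K 1) :
      mpoly_of_dhomog (c *: l) = c *: mpoly_of_dhomog l by exact: linearZ.
    apply: val_inj; rewrite [LHS]raddf_sum.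
    under eq_bigr do rewrite [_ (_ *: _)]vZ -tnth_nth tnth_mktuple LA scaler_sumr.
    rewrite exchange_big big1 //= => i _.
    under eq_bigr do rewrite scalerA.
    rewrite -scaler_suml; move/rowP/(_ i): vA0; rewrite !mxE => ->.
    by rewrite scale0r.
  move/freeP: fr => /(_ (fun k => v 0 k) v0) v_0.
  by apply/rowP => k; rewrite v_0 mxE.
pose B := invmx A.
pose phi : {rmorphism P -> P} :=
  comp_mpoly [tuple \sum_k B i k *: ('X_k : P) | i < n.+1].
pose psi : {rmorphism P -> P} := comp_mpoly [tuple L (e k) | k < n.+1].
have phiZ c f : phi (c *: f) = c *: phi f by apply: comp_mpolyZ.
have psiZ c f : psi (c *: f) = c *: psi f by apply: comp_mpolyZ.
have phiX i : phi 'X_i = \sum_k B i k *: 'X_k.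
  by rewrite [LHS]comp_mpolyXU -tnth_nth tnth_mktuple.
have psiX i : psi 'X_i = L (e i).
  by rewrite [LHS]comp_mpolyXU -tnth_nth tnth_mktuple.
clearbody phi psi.
have XB i : 'X_i = \sum_k B i k *: L (e k) :> P.
  under eq_bigr do rewrite LA scaler_sumr.
  rewrite exchange_big /=.
  under eq_bigr => j _ do
    (under eq_bigr do rewrite scalerA; rewrite -scaler_suml).
  have BA j : \sum_k B i k * A k j = (i == j)%:R.
    by move/matrixP/(_ i j): (mulVmx uA); rewrite !mxE.
  rewrite (bigD1 i) //= BA eqxx scale1r big1 ?addr0 // => j ji.
  by rewrite BA eq_sym (negPf ji) scale0r.
exists phi, psi, e; split=> //; first by move=> j; split=> /eT.
- move=> k; rewrite LA rmorph_sum /=.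
  under eq_bigr do rewrite phiZ phiX scaler_sumr.
  rewrite exchange_big /=.
  under eq_bigr => j _ do
    (under eq_bigr do rewrite scalerA; rewrite -scaler_suml).
  have AB j : \sum_i A k i * B i j = (k == j)%:R.
    by move/matrixP/(_ k j): (mulmxV uA); rewrite !mxE.
  rewrite (bigD1 k) //= AB eqxx scale1r big1 ?addr0 // => j jk.
  by rewrite AB eq_sym (negPf jk) scale0r.
- split.
    move=> f; rewrite [f]mpolyE !rmorph_sum.
    apply: eq_bigr => m _; rewrite phiZ psiZ; congr (_ *: _).
    rewrite mpolyXE_id !rmorph_prod; apply: eq_bigr => i _.
    rewrite !rmorphXn phiX rmorph_sum; congr (_ ^+ _); rewrite [RHS]XB.
    by apply: eq_bigr => k _; rewrite psiZ psiX.
  apply: ideal_gen_min; first exact: flat_is_ideal.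
  move=> _ [i _ <-]; rewrite XB; apply: ideal_sum => [|k _].
    exact: flat_is_ideal.
  rewrite -mul_mpolyC; case: (flat_is_ideal T) => _ _; apply.
  by apply: flat_form; apply/eT; exists k.
Qed.

(** In coordinates where the forms of [T] are variables, [<l_F>^k + <l_G>] is the
    monomial ideal of the monomials of degree at least [k] in the variables of [F]
    or divisible by a variable of [G].  The sets [F] and [G] may overlap, which
    permits [F = T], where [<l_F>] is the irrelevant ideal. *)
Lemma monomial_criterion (phi psi : {rmorphism P -> P}) (e : 'I_n.+1 -> 'I_s)
    (T F G : {set 'I_s}) k f :
  F \subset T -> G \subset T -> (forall j, j \in T -> exists i, e i = j) ->
  (forall i, phi (L (e i)) = 'X_i) -> (forall i, psi 'X_i = L (e i)) ->
  cancel phi psi ->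
  ideal_add (ideal_exp (flat F) k) (flat G) f <->
  forall m, m \in msupp (phi f) ->
    (k <= degree_in (fun i => e i \in F) m)%N ||
    (0 < degree_in (fun i => e i \in G) m)%N.
Proof.
move=> sFT sGT eT phiL psiX phiK.
have flat_phi J : J \subset T ->
    flat J `<=` phi @^-1`
      supported_in (fun m => 0 < degree_in (fun i => e i \in J) m)%N.
  move=> sJT; apply: ideal_gen_min.
    apply: ideal_preimage; apply: supported_in_ideal => m m'.
    by rewrite degree_inD addn_gt0 orbC => ->.
  move=> _ [j /= jJ <-] m; have [i ij] := eT j (fintype.subsetP sJT j jJ).
  by rewrite -ij phiL => /mem_msuppXP <-; rewrite degree_in1 ij jJ.
split.
  pose Q (m : 'X_{1..n.+1}) := (k <= degree_in (fun i => e i \in F) m)%N ||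
    (0 < degree_in (fun i => e i \in G) m)%N.
  suff : ideal_add (ideal_exp (flat F) k) (flat G) `<=` phi @^-1` supported_in Q.
    by move=> sub /sub.
  apply: ideal_add_min.
  - apply: ideal_preimage; apply: supported_in_ideal => m m'.
    rewrite /Q !degree_inD => /orP[h|h].
      by rewrite (leq_trans h (leq_addl _ _)).
    by rewrite (leq_trans h (leq_addl _ _)) orbT.
  - move=> g /(supported_in_exp (flat_phi F sFT)) gQ m mg.
    by rewrite /Q gQ.
  - by move=> g /(flat_phi G sGT) gQ m mg; rewrite /Q gQ ?orbT.
move=> fQ; rewrite -[f]phiK [phi f]mpolyE rmorph_sum big_seq_cond.
have idk := ideal_exp_ideal (flat F) k.
apply: ideal_sum => [|m /andP[mf _]].
  by apply: ideal_add_ideal => //; apply: flat_is_ideal.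
have psiXm J : ideal_exp (flat J) (degree_in (fun i => e i \in J) m) (psi 'X_[m]).
  rewrite mpolyXE_id rmorph_prod.
  under eq_bigr do rewrite rmorphXn psiX.
  by apply: ideal_exp_prod => i; apply: flat_form.
rewrite -mul_mpolyC rmorphM.
have /orP[mF|mG] := fQ m mf.
  apply: ideal_addl; first exact: flat_is_ideal.
  by case: idk => _ _; apply; apply: ideal_exp_le mF _ (psiXm F).
apply: ideal_addr => //; case: (flat_is_ideal G) => _ _; apply.
rewrite -(ideal_exp1 (flat_is_ideal G)).
exact: ideal_exp_le mG _ (psiXm G).
Qed.

(** Multiplication by [l_j] raises by one the exponent of a single variable, which
    counts for [F] when [j \in F] and is not one of those killed by [G]. *)
Lemma cancel_form_in T F G j k h :
  #|T| = n.+1 -> F \subset T -> G \subset T -> j \in T -> j \notin G ->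
  ideal_add (ideal_exp (flat F) k) (flat G) (L j * h) ->
  ideal_add (ideal_exp (flat F) (k - (j \in F))) (flat G) h.
Proof.
move=> cT sFT sGT jT jG.
have [phi [psi [e [eT phiL psiX [phiK _]]]]] := linear_coordinates cT.
have eT' i : i \in T -> exists i0, e i0 = i by move/eT.
move=> /(monomial_criterion _ _ sFT sGT eT' phiL psiX phiK) crit.
apply/(monomial_criterion _ _ sFT sGT eT' phiL psiX phiK) => m mh.
have [i ij] := eT' j jT; rewrite -ij rmorphM phiL in crit.
have /crit : (m + U_(i))%MM \in msupp ('X_i * phi h).
  by rewrite mulrC mcoeff_msupp addmC mcoeffMX -mcoeff_msupp.
rewrite !degree_inD !degree_in1 ij (negPf jG) addn0 => /orP[kF|->].
  by rewrite leq_subLR addnC kF.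
by rewrite orbT.
Qed.

Hypothesis hs : (n.+1 <= s)%N.

Lemma exists_frame J : (#|J| <= n.+1)%N ->
  exists2 T : {set 'I_s}, #|T| = n.+1 & J \subset T.
Proof.
move=> cJ.
have [|T [JT _ cT]] := @exists_intermediate_set _ J _ n.+1 (finset.subsetT J).
  by rewrite cJ cardsT card_ord.
by exists T.
Qed.

Lemma cancel_form F G j k h :
  j \notin G -> (#|F| + #|G| <= n)%N ->
  ideal_add (ideal_exp (flat F) k) (flat G) (L j * h) ->
  ideal_add (ideal_exp (flat F) (k - (j \in F))) (flat G) h.
Proof.
move=> jG cFG; have [|T cT] := @exists_frame (j |: (F :|: G)).
  rewrite -add1n (leq_trans (leq_of_leqif (leq_card_setU _ _))) //.
  rewrite cards1 leq_add2l (leq_trans _ cFG) //.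
  exact: leq_of_leqif (leq_card_setU _ _).
rewrite !finset.subUset finset.sub1set => /and3P[jT FT GT].
exact: cancel_form_in cT FT GT jT jG.
Qed.

Lemma irrelevant_flat T : #|T| = n.+1 -> flat T = M.
Proof.
move=> cT; apply/seteqP; split; first exact: flat_subset_irrelevant.
by have [phi [psi [e [_ _ _ []]]]] := linear_coordinates cT.
Qed.

Lemma cancel_form_irrelevant G j k h :
  j \notin G -> (#|G| <= n)%N ->
  ideal_add (ideal_exp M k) (flat G) (L j * h) ->
  ideal_add (ideal_exp M k.-1) (flat G) h.
Proof.
move=> jG cG; have [|T cT] := @exists_frame (j |: G).
  by rewrite cardsU1 jG.
rewrite finset.subUset finset.sub1set => /andP[jT GT].
rewrite -(irrelevant_flat cT) -subn1 => /(cancel_form_in cT _ GT jT jG).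
by rewrite jT; apply.
Qed.

(** * Products of forms with bounded multiplicities *)
Definition capped_ideal (b : 'I_s -> nat) (D : nat) : set P :=
  ideal_gen [set f | exists a : 'I_s -> nat,
    [/\ forall i, (a i <= b i)%N, (\sum_i a i)%N = D & f = \prod_i L i ^+ a i]].

Lemma capped_ideal_is_ideal b D : is_ideal (capped_ideal b D).
Proof. exact: ideal_gen_ideal. Qed.

Lemma capped0 b f : capped_ideal b 0 f.
Proof.
rewrite -[f]mulr1; case: (capped_ideal_is_ideal b 0) => _ _; apply.
apply: sub_ideal_gen; exists (fun=> 0%N); split=> //; first by rewrite big1.
by rewrite big1.
Qed.

Lemma capped_subset b b' D :
  (forall i, b i <= b' i)%N -> capped_ideal b D `<=` capped_ideal b' D.
Proof.
move=> bb'; apply: ideal_gen_subset => _ [a [ab aD ->]].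
by exists a; split=> // i; apply: leq_trans (bb' i).
Qed.

Lemma capped_flat b D F :
  capped_ideal b D `<=` ideal_exp (flat F) (D - \sum_(i | i \notin F) b i).
Proof.
apply: ideal_gen_min; first exact: ideal_exp_ideal.
move=> _ [a [ab <- ->]].
apply: (@ideal_exp_le _ _ _ (\sum_(i | i \in F) a i)); last first.
  by apply: ideal_exp_prod => i; apply: flat_form.
by rewrite (bigID (mem F)) /= leq_subLR addnC leq_add2r leq_sum.
Qed.

Lemma capped_irrelevant b D : capped_ideal b D `<=` ideal_exp M D.
Proof.
move=> f /(@capped_flat b D [set: 'I_s]%SET).
rewrite big1 => [|i]; last by rewrite inE.
by rewrite subn0; apply: ideal_exp_subset; apply: flat_subset_irrelevant.
Qed.

Lemma capped_mul b b' D D' g h :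
  capped_ideal b D g -> capped_ideal b' D' h ->
  capped_ideal (fun i => b i + b' i)%N (D + D') (g * h).
Proof.
move=> bg b'h.
have [I0 ID IM] := capped_ideal_is_ideal (fun i => b i + b' i)%N (D + D').
pose C u := [set v | capped_ideal (fun i => b i + b' i)%N (D + D') (u * v)].
have idC u : is_ideal (C u).
  split=> [|v w Cv Cw|v w Cw]; rewrite /C /= ?mulr0 //.
    by rewrite mulrDr; apply: ID.
  by rewrite mulrCA; apply: IM.
suff: C h g by rewrite /C /= mulrC.
move: g bg; apply: ideal_gen_min => // _ [a [ab aD ->]].
suff: C (\prod_i L i ^+ a i) h by rewrite /C /= mulrC.
move: h b'h; apply: ideal_gen_min => // _ [a' [ab' aD' ->]].
apply: sub_ideal_gen; exists (fun i => a i + a' i)%N; split.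
- by move=> i; apply: leq_add.
- by rewrite big_split aD aD'.
- by rewrite -big_split; apply: eq_bigr => i _; rewrite exprD.
Qed.

Lemma capped_mul_form b b' D j h :
  (forall i, (i == j) + b' i <= b i)%N -> capped_ideal b' D h ->
  capped_ideal b D.+1 (L j * h).
Proof.
move=> b'b b'h; apply: (capped_subset b'b); rewrite -add1n; apply: capped_mul => //.
apply: sub_ideal_gen; exists (fun i => i == j); split=> //.
  by rewrite (bigD1 j) //= eqxx big1 // => i /negPf->.
by rewrite (bigD1 j) //= eqxx big1 ?mulr1 // => i /negPf->.
Qed.

Lemma capped_exp b D k :
  ideal_exp (capped_ideal b D) k `<=` capped_ideal (fun i => k * b i)%N (k * D).
Proof.
elim: k => [f _|k IHk]; first exact: capped0.
apply: ideal_gen_min; first exact: capped_ideal_is_ideal.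
move=> _ [g [h [bg /IHk bh ->]]]; rewrite mulSn.
by apply: capped_subset (capped_mul bg bh) => i; rewrite mulSn.
Qed.

(** * Reduction modulo a form *)
Lemma flat_setU1 G j g :
  flat (j |: G) g -> exists h, flat G (g - L j * h).
Proof.
have [I0 ID IM] := flat_is_ideal G.
move: g; apply: ideal_gen_min.
  split=> [|u v [h Gh] [h' Gh']|u v [h Gh]].
  - by exists 0; rewrite mulr0 subr0.
  - by exists (h + h'); rewrite mulrDr opprD addrACA; apply: ID.
  - by exists (u * h); rewrite mulrCA -mulrBr; apply: IM.
move=> _ [i /= + <-]; rewrite !inE => /orP[/eqP->|iG].
  by exists 1; rewrite mulr1 subrr.
by exists 0; rewrite mulr0 subr0; apply: flat_form.
Qed.

(** Passes from the condition on a flat through [l_j] to the condition that it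
    induces modulo [l_j]. *)
Lemma flat_mod_form F G j k :
  ideal_add (ideal_exp (flat (j |: F)) k) (flat G) `<=`
  ideal_add (ideal_exp (flat F) k) (flat (j |: G)).
Proof.
have idF := ideal_exp_ideal (flat F) k.
have idG := flat_is_ideal (j |: G).
apply: ideal_add_min; first exact: ideal_add_ideal.
  apply: classical_sets.subset_trans (ideal_exp_add (flat_is_ideal F) idG).
  apply: ideal_exp_subset => f /flat_setU1[h Fh].
  exists (f - L j * h), (h * L j); rewrite [h * _]mulrC subrK; split=> //.
  by rewrite mulrC; case: idG => _ _; apply; apply: flat_form; rewrite !inE eqxx.
move=> f Gf; apply: ideal_addr => //; apply: flat_subset Gf.
exact: finset.subsetUr.
Qed.

(** When [f] lies in a capped ideal modulo [l_j], the correction [l_j * h] satisfies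
    the same ideal conditions as [f], as long as they hold on the capped ideal. *)
Lemma lift_mod_form b D G j f :
  ideal_add (capped_ideal b D) (flat (j |: G)) f ->
  exists h, forall I, is_ideal I -> capped_ideal b D `<=` I ->
    ideal_add I (flat G) f <-> ideal_add I (flat G) (L j * h).
Proof.
move=> [p [q [bp /flat_setU1[h Gh] ->]]]; exists h => I idI bI.
have idIG := ideal_add_ideal idI (flat_is_ideal G).
have IGp : ideal_add I (flat G) p.
  by apply: ideal_addl; [apply: flat_is_ideal | apply: bI].
have IGh : ideal_add I (flat G) (q - L j * h) by apply: ideal_addr.
case: (idIG) => _ ID _; split=> [IGf|IGjh].
  have -> : L j * h = p + q - p - (q - L j * h).
    by rewrite (addrC p q) addrK opprB addrC subrK.
  by do 2!apply: idealB => //.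
by apply: (ID) => //; rewrite -[q](subrK (L j * h)); apply: ID.
Qed.

(** The induction is on the sum of the caps.  It decreases both when [j] joins the
    forms set to zero and when [l_j] is divided out. *)
Lemma capped_ideal_of_local_conditions b G D f :
  (#|G| <= n.+1)%N -> (forall i, i \in G -> b i = 0%N) ->
  ideal_add (ideal_exp M D) (flat G) f ->
  (forall F, (#|F| + #|G| <= n)%N ->
     ideal_add (ideal_exp (flat F) (D - \sum_(i | i \notin F) b i)) (flat G) f) ->
  ideal_add (capped_ideal b D) (flat G) f.
Proof.
have [N] := ubnP (\sum_i b i)%N.
elim: N b G D f => [//|N IHN] b G [|D] f bN cG bG Mf Ff.
  by apply: ideal_addl; [apply: flat_is_ideal | apply: capped0].
have idG := flat_is_ideal G.
move: cG; rewrite leq_eqVlt => /predU1P[cG|]; last rewrite ltnS => cG.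
  apply: ideal_addr; first exact: capped_ideal_is_ideal.
  (* n + 1 forms span all linear forms, so nothing survives modulo G. *)
  apply: ideal_add_min Mf => //; rewrite -(irrelevant_flat cG).
  rewrite -[X in _ `<=` X](ideal_exp1 idG); exact: ideal_exp_le.
have [j bj|b0] := pickP (fun j => 0 < b j)%N; last first.
  apply: ideal_addr; first exact: capped_ideal_is_ideal.
  (* All caps are zero, so no product of positive degree exists; the empty flat,
     whose ideal is zero, forces f to vanish modulo G. *)
  have := Ff finset.set0; rewrite cards0 => /(_ cG).
  rewrite big1 => [|i _]; last by apply/eqP; rewrite -leqn0 leqNgt b0.
  apply: ideal_add_min => //.
  apply: classical_sets.subset_trans (flat_subset (finset.sub0set G)).
  rewrite -[X in _ `<=` X](ideal_exp1 (flat_is_ideal _)); exact: ideal_exp_le.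
have jG : j \notin G by apply: contraL bj => /bG ->.
(* The caps of the problem modulo l_j, and of the problem for the quotient by l_j. *)
pose bmod i := if i == j then 0%N else b i.
pose bdiv i := (b i - (i == j))%N.
have bmodb i : (bmod i <= b i)%N by rewrite /bmod; case: eqP.
have bdivb i : (bdiv i <= b i)%N by apply: leq_subr.
have bdivN (X : pred 'I_s) : X j ->
    (\sum_(i | X i) b i = (\sum_(i | X i) bdiv i).+1)%N.
  move=> Xj; rewrite !(bigD1 (P := X) j Xj) /= /bdiv eqxx -addSn subn1 prednK //.
  congr (_ + _)%N; apply: eq_bigr => i /andP[_ /negPf->].
  by rewrite subn0.
have bdivE (X : pred 'I_s) : ~~ X j ->
    (\sum_(i | X i) bdiv i = \sum_(i | X i) b i)%N.
  move=> Xj; apply: eq_bigr => i Xi; rewrite /bdiv.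
  by have [ij|] := eqVneq i j; rewrite ?subn0 //; rewrite -ij Xi in Xj.
have bmodN : (\sum_i bmod i < \sum_i b i)%N.
  rewrite !(bigD1 (P := predT) j) //= /bmod eqxx add0n -add1n leq_add //.
  by apply: leq_sum => i /negPf->.
have sub_jG := flat_subset (finset.subsetUr [set j]%SET G).
have /lift_mod_form[h hP] : ideal_add (capped_ideal bmod D.+1) (flat (j |: G)) f.
  apply: IHN.
  - exact: leq_trans bmodN bN.
  - by rewrite cardsU1 jG.
  - move=> i; rewrite /bmod; case: eqVneq => //= ij.
    by rewrite !inE (negPf ij) => /bG.
  - exact: ideal_add_subset sub_jG _ Mf.
  (* The condition for F modulo l_j is the one for the flat F with j added. *)
  - move=> F; rewrite cardsU1 jG addnCA add1n => cF.
    have : ideal_add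
        (ideal_exp (flat (j |: F)) (D.+1 - \sum_(i | i \notin F) bmod i))
        (flat G) f.
      have -> : (\sum_(i | i \notin F) bmod i = \sum_(i | i \notin j |: F) b i)%N.
        rewrite big_mkcond [RHS]big_mkcond; apply: eq_bigr => i _.
        by rewrite !inE /bmod; case: eqP => //=; rewrite if_same.
      apply: Ff; apply: leq_trans cF; rewrite -addSn leq_add2r -add1n.
      by rewrite cardsU1 leq_add2r; case: (_ \notin _).
    exact: flat_mod_form.
have : ideal_add (capped_ideal bdiv D) (flat G) h.
  apply: IHN => //.
  - by move: bN; rewrite (bdivN predT isT) ltnS.
  - exact: leqW.
  - by move=> i /bG; rewrite /bdiv => ->.
  - rewrite -[D]/(D.+1.-1); apply: (cancel_form_irrelevant jG cG).
    apply/hP => //; first exact: ideal_exp_ideal.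
    exact: capped_irrelevant.
  - move=> F cF; have -> : (D - \sum_(i | i \notin F) bdiv i =
        D.+1 - \sum_(i | i \notin F) b i - (j \in F))%N.
      have [jF|jF] := boolP (j \in F).
        by rewrite (bdivE _ _) ?jF // subnAC subn1.
      by rewrite (bdivN _ jF) subSS subn0.
    apply: cancel_form => //; apply/hP; last exact: Ff.
      exact: ideal_exp_ideal.
    apply: classical_sets.subset_trans (@capped_flat _ _ F).
    exact: capped_subset.
move=> [p [q [bp Gq Eh]]]; apply/hP.
- exact: capped_ideal_is_ideal.
- exact: capped_subset.
exists (L j * p), (L j * q); rewrite Eh mulrDr; split=> //.
  apply: capped_mul_form bp => i; rewrite /bdiv.
  by case: eqP => [->|_]; rewrite ?subn0 // add1n subn1 prednK.
by case: idG => _ _; apply.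
Qed.

(** * Star configurations and their powers *)

(** The ideal of a star configuration of codimension [c] on the forms of [A] is
    generated by products of [#|A| - c + 1] distinct forms.  Modulo [l_j] one obtains
    codimension [c - 1] on [A] without [j]; after division by [l_j], codimension [c]
    on [A] without [j].  The truncated difference [#|A|.+1 - c] covers [c > #|A|],
    where there is no condition and the ideal is the whole ring. *)
Lemma star_capped (A : {set 'I_s}) c G f :
  (c + #|G| <= n)%N -> (forall j, j \in A -> j \notin G) ->
  (forall F, F \subset A -> #|F| = c ->
     ideal_add (ideal_exp (flat F) 1) (flat G) f) ->
  ideal_add (capped_ideal (fun i => i \in A) (#|A|.+1 - c)) (flat G) f.
Proof.
have [N] := ubnP #|A|; elim: N A c G f => [//|N IHN] A [|c] G f AN cG AG Ff.
  apply: ideal_addr; first exact: capped_ideal_is_ideal.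
  have := Ff _ (finset.sub0set A) (cards0 _).
  rewrite (ideal_exp1 (flat_is_ideal _)); apply: ideal_add_min => //.
    exact: flat_is_ideal.
  exact: flat_subset (finset.sub0set G).
have [A0|[j jA]] := set_0Vmem A.
  apply: ideal_addl; first exact: flat_is_ideal.
  by rewrite A0 cards0 subSS sub0n; apply: capped0.
have jG := AG j jA.
have sA := subD1set A j.
have cA : #|A| = #|A :\ j|.+1 by rewrite (cardsD1 j A) jA.
have A'N : (#|A :\ j| < N)%N by rewrite cA ltnS in AN.
rewrite cA subSS; set D := (_ - c)%N.
have A'A i : ((i \in A :\ j) <= (i \in A))%N.
  by rewrite !inE; case: (i \in A); case: (i == j).
have /lift_mod_form[h hP] :
    ideal_add (capped_ideal (fun i => i \in A :\ j) D) (flat (j |: G)) f.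
  apply: IHN => //.
  - by rewrite cardsU1 jG addnA addn1.
  - by move=> i; rewrite !inE negb_or => /andP[-> /AG].
  - move=> F sF cF; apply: flat_mod_form; apply: Ff.
      by rewrite finset.subUset finset.sub1set jA (fintype.subset_trans sF sA).
    rewrite cardsU1 cF; have [/(fintype.subsetP sF)|//] := boolP (j \in F).
    by rewrite !inE eqxx.
have [D0|D_gt0] := posnP D.
  by apply: ideal_addl; [apply: flat_is_ideal | rewrite D0; apply: capped0].
have : ideal_add (capped_ideal (fun i => i \in A :\ j) D.-1) (flat G) h.
  have -> : D.-1 = (#|A :\ j|.+1 - c.+1)%N.
    by rewrite /D subSS -subn1 subnAC subn1.
  apply: IHN => //; first by move=> i /(fintype.subsetP sA)/AG.
  move=> F sF cF; have jF : j \notin F.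
    by apply/negP => /(fintype.subsetP sF); rewrite !inE eqxx.
  have := @cancel_form F G j 1 h jG; rewrite (negPf jF) cF; apply=> //.
  apply/hP; first exact: ideal_exp_ideal.
    apply: classical_sets.subset_trans (@capped_flat _ _ F) _.
    apply: ideal_exp_le.
    have -> : (\sum_(i | i \notin F) (i \in A :\ j) = #|A :\ j :\: F|)%N.
      rewrite -sum1_card big_mkcond [RHS]big_mkcond; apply: eq_bigr => i _.
      by rewrite !inE; case: (i \in F) => //=; case: (_ && _).
    have cFA := subset_leq_card sF; rewrite cardsDS // cF.
    rewrite cF in cFA.
    by rewrite subn_gt0 /D (subSn (ltnW cFA)) ltnS leq_sub2l.
  apply: Ff => //; exact: fintype.subset_trans sF sA.
move=> [p [q [bp Gq Eh]]]; apply/hP.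
- exact: capped_ideal_is_ideal.
- exact: capped_subset.
exists (L j * p), (L j * q); rewrite Eh mulrDr; split=> //.
  rewrite -(prednK D_gt0); apply: capped_mul_form bp => i; rewrite !inE.
  by case: eqP => [->|_]; rewrite ?jA.
by case: (flat_is_ideal G) => _ _; apply.
Qed.

Lemma star_subset_capped c : (c <= n)%N ->
  star_ideal ell c `<=` capped_ideal (fun=> 1%N) (s.+1 - c).
Proof.
move=> cn f If.
have : ideal_add
    (capped_ideal (fun i => i \in [set: 'I_s]%SET) (#|[set: 'I_s]%SET|.+1 - c))
    (flat finset.set0) f.
  apply: star_capped; first by rewrite cards0 addn0.
    by move=> j _; rewrite inE.
  move=> F _ cF; apply: ideal_addl; first exact: flat_is_ideal.
  by rewrite (ideal_exp1 (flat_is_ideal _)); apply: If.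
rewrite cardsT card_ord; apply: ideal_add_min; first exact: capped_ideal_is_ideal.
  by apply: capped_subset => i; apply: leq_b1.
apply: ideal_gen_min; first exact: capped_ideal_is_ideal.
by move=> f0 [i /=]; rewrite inE.
Qed.

(** By counting, [B] meets every set of [c] indices. *)
Lemma prod_forms_star c (B : {set 'I_s}) :
  (s < #|B| + c)%N -> star_ideal ell c (\prod_(i in B) L i).
Proof.
move=> cB F /= cF; have [i /setIP[iB iF]] : exists i, i \in B :&: F.
  apply/set0Pn; rewrite -card_gt0 -(ltn_add2l #|B :|: F|) addn0.
  rewrite cardsUI cF; apply: leq_ltn_trans cB.
  by rewrite -[X in (_ <= X)%N]card_ord max_card.
rewrite (bigD1 i) //= mulrC; case: (flat_is_ideal F) => _ _; apply.
exact: flat_form.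
Qed.

(** Splits off one squarefree product of degree [d] at a time. *)
Lemma capped_ideal_subset_exp (I : set P) d m :
  (forall B : {set 'I_s}, #|B| = d -> I (\prod_(i in B) L i)) ->
  capped_ideal (fun=> m) (d * m) `<=` ideal_exp I m.
Proof.
move=> IB; apply: ideal_gen_min; first exact: ideal_exp_ideal.
move=> _ [a [am aD ->]]; elim: m a am aD => [//|m IHm] a am aD.
(* The set B of split-off indices must contain X for the remaining exponents to be
   at most m, and be contained in Y for them to be nonnegative.  A set of size d fits
   in between because the exponents sum to d (m + 1). *)
pose X := finset (fun i => a i == m.+1); pose Y := finset (fun i => 0 < a i)%N.
have XY : X \subset Y by apply/fintype.subsetP => i; rewrite !inE => /eqP->.
have [|B [XB BY cB]] := @exists_intermediate_set _ X Y d XY.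
  rewrite -(leq_pmul2r (ltn0Sn m)) -[X in _ && X](leq_pmul2r (ltn0Sn m)) -aD.
  rewrite -!sum_nat_const; apply/andP; split.
    rewrite [X in (_ <= X)%N](bigID (mem X)) /= -[leqLHS]addn0 leq_add //.
    by apply: leq_sum => i; rewrite inE => /eqP->.
  rewrite (bigID (mem Y)) /= [X in (_ + X)%N]big1 ?addn0 ?leq_sum // => i.
  by rewrite inE lt0n negbK => /eqP.
have aB i : (a i = (i \in B) + (a i - (i \in B)))%N.
  have [/(fintype.subsetP BY)|_] := boolP (i \in B); last by rewrite subn0.
  by rewrite inE => a0; rewrite subnKC.
have -> : \prod_i L i ^+ a i =
    (\prod_(i in B) L i) * \prod_i L i ^+ (a i - (i \in B)).
  rewrite [X in _ = X * _]big_mkcond -big_split; apply: eq_bigr => i _.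
  by rewrite {1}aB exprD; case: (i \in B).
apply: sub_ideal_gen; do 2!eexists; split; last by [].
  exact: IB.
apply: IHm => [i|].
  have [iB|iB] := boolP (i \in B).
    by rewrite leq_subLR add1n.
  rewrite subn0 -ltnS ltn_neqAle am andbT; apply: contra iB => iX.
  by apply: (fintype.subsetP XB); rewrite inE.
have : (\sum_i a i = #|B| + \sum_i (a i - (i \in B)))%N.
  rewrite -sum1_card [X in (_ = X + _)%N]big_mkcond -big_split; apply: eq_bigr => i _.
  by rewrite {1}aB; case: (i \in B).
by rewrite aD cB mulnS => /addnI.
Qed.

End Forms.
End StarConfigurationPowers.

Theorem theorem3p2 (K : fieldType) (n s : nat) (hs : (n.+1 <= s)%N)
    (ell : 'I_s -> dhomog n.+1 K 1) (hgen : generic ell)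
    (c : nat) (hc : (1 <= c <= n)%N) (m : nat) (hm : (1 <= m)%N) :
  ideal_exp (star_ideal ell c) m =
  \bigcap_(j in [set j : nat | (c <= j <= n)%N])
      star_symbolic_power ell j ((j - c + 1) * m)%N
  `&` ideal_exp (irrelevant_ideal K n) ((s - c + 1) * m)%N.
Proof.
case/andP: hc => _ cn; have cs : c <= s by apply: leq_trans cn (ltnW hs).
(* The exponent attached to F is (#|F| - c + 1) m when #|F| >= c and 0 otherwise. *)
have excess (F : {set 'I_s}) :
    (s - c + 1) * m - \sum_(i | i \notin F) m = (s - c + 1 - (s - #|F|)) * m.
  have -> : \sum_(i | i \notin F) m = \sum_(i in ~: F) m.
    by apply: eq_bigl => i; rewrite inE.
  by rewrite sum_nat_const cardsCs finset.setCK card_ord [RHS]mulnBl.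
have symb (F : {set 'I_s}) : c <= #|F| ->
    s - c + 1 - (s - #|F|) = #|F| - c + 1.
  move=> cF; have Fs : #|F| <= s by rewrite -[s in _ <= s]card_ord max_card.
  lia.
apply/seteqP; split=> f.
  move=> /(ideal_exp_subset (star_subset_capped hgen hs cn))/capped_exp fJ.
  have {}fJ : capped_ideal ell (fun=> m) ((s - c + 1) * m) f.
    rewrite addn1 -subSn // mulnC.
    by apply: capped_subset fJ => i; rewrite muln1.
  split; last exact: capped_irrelevant fJ.
  move=> j /= /andP[cj jn] F /= cF; have := @capped_flat _ _ _ _ _ _ F _ fJ.
  by rewrite excess symb cF.
move=> [sf Mf].
have symbf j (F : {set 'I_s}) : c <= j <= n -> #|F| = j ->
    ideal_exp (flat_ideal ell F) ((j - c + 1) * m) f.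
  by move=> cj cF; apply: (sf j cj F cF).
apply: (@capped_ideal_subset_exp _ _ _ ell _ (s - c + 1)).
  by move=> B cB; apply: prod_forms_star; rewrite cB addn1 addSn subnK.
have : ideal_add (capped_ideal ell (fun=> m) ((s - c + 1) * m))
         (flat_ideal ell finset.set0) f.
  apply: (capped_ideal_of_local_conditions hgen hs).
  - by rewrite cards0.
  - by move=> i; rewrite inE.
  - by apply: ideal_addl => //; apply: flat_is_ideal.
  - move=> F; rewrite cards0 addn0 => cF; apply: ideal_addl.
      exact: flat_is_ideal.
    rewrite excess; have [Fc|cF'] := ltnP #|F| c.
      by have -> : s - c + 1 - (s - #|F|) = 0 by lia.
    by rewrite symb //; apply: symbf; rewrite ?cF'.
apply: ideal_add_min; first exact: capped_ideal_is_ideal.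
  by [].
apply: ideal_gen_min; first exact: capped_ideal_is_ideal.
by move=> f0 [i /=]; rewrite inE.
Qed.
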